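(* Let $R$ be a prime ring, let $\sigma$ be an automorphism of $R$, and let $n\geq 3$ be an integer. If there exists a nonzero skew $n$-derivation $\Delta: R\times R\times\cdots\times R\rightarrow R$ ($n$ arguments) with respect to $\sigma$, then $R$ is commutative.
   Context: Rings are associative; no identity element is assumed. A ring $R$ is prime if $aRb\neq 0$ for all $a,b\in R\setminus\{0\}$. For an automorphism $\sigma$ of $R$, an additive map $\mu:R\to R$ is a $\sigma$-derivation if $\mu(xy)=\sigma(x)\mu(y)+\mu(x)y$ for all $x,y\in R$. A map $\Delta:R\times\cdots\times R\to R$ of $n$ arguments is a skew $n$-derivation with respect to $\sigma$ if it is a $\sigma$-derivation in each argument when the other $n-1$ arguments are fixed; that is, for every $i$ and all fixed $a_1,\ldots,a_{i-1},a_{i+1},\ldots,a_n\in R$ and all $x_i,y_i\in R$, $$\Delta(a_1,\ldots,x_i+y_i,\ldots,a_n)=\Delta(a_1,\ldots,x_i,\ldots,a_n)+\Delta(a_1,\ldots,y_i,\ldots,a_n),$$ $$\Delta(a_1,\ldots,x_iy_i,\ldots,a_n)=\Delta(a_1,\ldots,x_i,\ldots,a_n)y_i+\sigma(x_i)\Delta(a_1,\ldots,y_i,\ldots,a_n).$$ No symmetry of $\Delta$ in its arguments is assumed. $\Delta$ is nonzero if it is not identically zero. *)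

(* Defs.v *)
From HB Require Import structures.
From mathcomp Require Import all_boot all_algebra.

Set Implicit Arguments.
Unset Strict Implicit.
Unset Printing Implicit Defensive.

Import GRing.Theory.
Local Open Scope ring_scope.

(* MathComp's ring structures all carry a unit [1], so associative rings
   without a required identity element are declared here as a structure
   over [zmodType]. *)
HB.mixin Record Zmodule_isRng R of GRing.Zmodule R := {
  rngmul : R -> R -> R;
  rngmulA : associative rngmul;
  rngmulDl : left_distributive rngmul +%R;
  rngmulDr : right_distributive rngmul +%R
}.

#[short(type="rngType")]
HB.structure Definition Rng := { R of Zmodule_isRng R & GRing.Zmodule R }.

Declare Scope rng_scope.
Notation "x ** y" := (rngmul x y)
  (at level 40, left associativity) : rng_scope.
Open Scope rng_scope.

Section RngDefs.
Variable R : rngType.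

Definition prime_rng : Prop :=
  forall a b : R, a != 0 -> b != 0 -> exists r : R, a ** r ** b != 0.

Definition commutative_rng : Prop := forall x y : R, x ** y = y ** x.

Definition rng_automorphism (sigma : R -> R) : Prop :=
  [/\ bijective sigma,
      forall x y, sigma (x + y) = sigma x + sigma y
    & forall x y, sigma (x ** y) = sigma x ** sigma y].

Definition skew_derivation (sigma mu : R -> R) : Prop :=
  (forall x y, mu (x + y) = mu x + mu y) /\
  (forall x y, mu (x ** y) = sigma x ** mu y + mu x ** y).

Definition set_arg (n : nat) (a : {ffun 'I_n -> R}) (i : 'I_n) (x : R) :
    {ffun 'I_n -> R} :=
  [ffun j => if j == i then x else a j].

(* A map of [n] arguments takes the whole argument list as one finite function;
   the value [a i] is irrelevant in the condition for the [i]-th argument. *)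
Definition skew_n_derivation (n : nat) (sigma : R -> R)
    (Delta : {ffun 'I_n -> R} -> R) : Prop :=
  forall (i : 'I_n) (a : {ffun 'I_n -> R}),
    skew_derivation sigma (fun x => Delta (set_arg a i x)).

End RngDefs.

Arguments prime_rng : clear implicits.
Arguments commutative_rng : clear implicits.

(* Main.v *)
Require Import Defs.
From HB Require Import structures.
From mathcomp Require Import all_boot all_algebra.

Set Implicit Arguments.
Unset Strict Implicit.
Unset Printing Implicit Defensive.

Import GRing.Theory.
Local Open Scope ring_scope.

(** Only three arguments matter: freezing the others turns [Delta] into a map
    [T u v z] that is a [sigma]-derivation in each variable, and the claim is
    that [T = 0] when [R] is prime and not commutative.

    Expanding a [sigma]-biderivation [D] at a pair of products in the two
    possible orders gives
      [D x y w [u, v] = sigma [x, y] sigma w D u v]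
    ([skew_biderivation_comm]), so [D] vanishes on commuting pairs
    ([skew_biderivation_commuting0]).

    For fixed [z], this identity holds for [D = T _ _ z].  Comparing it at [z]
    replaced by the product [z u] with the identities at [z] and at [u], and
    using [T u v u = 0], shows that [sigma [x, y]] annihilates the difference of
    [sigma u sigma w T u v z] and [sigma w T u v z u]; since the commutators
    have no common nonzero right annihilator, the two are equal
    ([skew_triderivation_shift]).  Thus [u] moves from the right of [T u v z] to
    the left of any [sigma w].  Doing this for [w] and for the product [v w]
    shows that [sigma [u, v] R T u v z = 0].  By primeness [T u v z = 0] or
    [u] and [v] commute, and in the latter case [T u v z = 0] again. *)

Section RngArith.
Variable R : rngType.
Implicit Types x y z a b : R.

Lemma rngmul0r x : 0 ** x = 0.
Proof. by apply: (addrI (0 ** x)); rewrite -rngmulDl !addr0. Qed.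

Lemma rngmulr0 x : x ** 0 = 0.
Proof. by apply: (addrI (x ** 0)); rewrite -rngmulDr !addr0. Qed.

Lemma rngmulNr x y : (- x) ** y = - (x ** y).
Proof. by apply/eqP; rewrite -addr_eq0 -rngmulDl addNr rngmul0r. Qed.

Lemma rngmulrN x y : x ** (- y) = - (x ** y).
Proof. by apply/eqP; rewrite -addr_eq0 -rngmulDr addNr rngmulr0. Qed.

Lemma rngmulBl x y z : (x - y) ** z = x ** z - y ** z.
Proof. by rewrite rngmulDl rngmulNr. Qed.

Lemma rngmulBr x y z : z ** (x - y) = z ** x - z ** y.
Proof. by rewrite rngmulDr rngmulrN. Qed.

Definition rngcomm x y := x ** y - y ** x.

Lemma rngcommMr x y z :
  rngcomm x (y ** z) = rngcomm x y ** z + y ** rngcomm x z.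
Proof. by rewrite /rngcomm rngmulBl rngmulBr !rngmulA addrA subrK. Qed.

Lemma prime_rng_eq0 a b :
  prime_rng R -> (forall r, a ** r ** b = 0) -> a != 0 -> b = 0.
Proof.
move=> hR ab0 a0; apply/eqP; apply: contraT => b0.
by have [r] := hR a b a0 b0; rewrite ab0 eqxx.
Qed.

(** The Leibniz rule for [rngcomm x0] applied to [y0 r] upgrades annihilation of
    [b] by commutators to [[x0, y0] r b = 0] for all [r], where primeness
    applies. *)
Lemma comm_annihilator0 x0 y0 b :
  prime_rng R -> rngcomm x0 y0 != 0 ->
  (forall x y, rngcomm x y ** b = 0) -> b = 0.
Proof.
move=> hR xy0 cb0; apply: prime_rng_eq0 xy0 => // r.
by have := cb0 x0 (y0 ** r); rewrite rngcommMr rngmulDl -[_ + _]addrC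
  -rngmulA cb0 rngmulr0 add0r.
Qed.

End RngArith.

Section SkewDerivations.
Variables (R : rngType) (sigma : R -> R).
Hypotheses (hR : prime_rng R) (hsigma : rng_automorphism sigma).
Implicit Types (x y z u v w : R) (mu : R -> R) (D : R -> R -> R).

Lemma rng_automorphism0 : sigma 0 = 0.
Proof.
by case: hsigma => _ sD _; apply: (addrI (sigma 0)); rewrite -sD !addr0.
Qed.

Lemma rng_automorphismN x : sigma (- x) = - sigma x.
Proof.
case: hsigma => _ sD _; apply/eqP.
by rewrite -addr_eq0 -sD addNr rng_automorphism0.
Qed.

Lemma rng_automorphism_comm x y :
  sigma (rngcomm x y) = rngcomm (sigma x) (sigma y).
Proof. by case: hsigma => _ sD sM; rewrite sD rng_automorphismN !sM. Qed.

Lemma skew_derivationM mu x y :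
  skew_derivation sigma mu -> mu (x ** y) = sigma x ** mu y + mu x ** y.
Proof. by case=> _; apply. Qed.

Definition skew_biderivation D : Prop :=
  (forall y, skew_derivation sigma (D^~ y)) /\
  (forall x, skew_derivation sigma (D x)).

Lemma skew_biderivation_comm1 D x y u v : skew_biderivation D ->
  D x y ** rngcomm u v = sigma (rngcomm x y) ** D u v.
Proof.
move=> [Dl Dr].
have cancel (p q p' q' b c : R) :
    p + c + (b + q) = p' + b + (c + q') -> q' - q = p - p'.
  rewrite [b + q]addrC [c + q']addrC addrACA [RHS]addrACA [b + c]addrC.
  move=> /addIr E.
  by apply/eqP; rewrite subr_eq addrAC eq_sym subr_eq E addrC.
(* [D (x u) (y v)], expanded first in the left and first in the right slot. *)
have E1 : D (x ** u) (y ** v) =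
    sigma x ** (sigma y ** D u v + D u y ** v)
    + (sigma y ** D x v + D x y ** v) ** u.
  by rewrite (skew_derivationM x u (Dl _)) !(skew_derivationM y v (Dr _)).
have E2 : D (x ** u) (y ** v) =
    sigma y ** (sigma x ** D u v + D x v ** u)
    + (sigma x ** D u y + D x y ** u) ** v.
  by rewrite (skew_derivationM y v (Dr _)) !(skew_derivationM x u (Dl _)).
move: E1; rewrite E2 rng_automorphism_comm /rngcomm rngmulBl rngmulBr.
by rewrite !rngmulDl !rngmulDr !rngmulA => E; apply: cancel (esym E).
Qed.

(** Substituting [w v] for [v] in [skew_biderivation_comm1] inserts an arbitrary
    [w], which is what makes primeness applicable. *)
Lemma skew_biderivation_comm D x y u v w : skew_biderivation D ->
  D x y ** w ** rngcomm u v = sigma (rngcomm x y) ** sigma w ** D u v.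
Proof.
move=> bD; have := skew_biderivation_comm1 x y u (w ** v) bD.
rewrite (skew_derivationM _ _ (bD.2 u)) rngcommMr !rngmulDr !rngmulA.
by rewrite (skew_biderivation_comm1 _ _ _ _ bD) addrC => /addIr.
Qed.

Variables (x0 y0 : R).
Hypothesis xy0 : rngcomm x0 y0 != 0.

Lemma skew_biderivation_commuting0 D x y :
  skew_biderivation D -> rngcomm x y = 0 -> D x y = 0.
Proof.
move=> bD xy; apply/eqP; apply: contraT => D0; case/eqP: xy0.
apply: prime_rng_eq0 D0 => // r.
by rewrite skew_biderivation_comm // xy rng_automorphism0 !rngmul0r.
Qed.

Definition skew_triderivation (T : R -> R -> R -> R) : Prop :=
  [/\ forall y z, skew_derivation sigma (fun x => T x y z),
      forall x z, skew_derivation sigma (fun y => T x y z)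
    & forall x y, skew_derivation sigma (T x y)].

(** The third variable enters the commutator identity of the first two only
    as a parameter, yet [T] is a skew derivation in it; the two facts are
    compatible only if right multiplication of [T u v z] by [u] can be traded
    for left multiplication by [sigma u], across an arbitrary [sigma w]. *)
Lemma skew_triderivation_shift T u v z w : skew_triderivation T ->
  sigma u ** sigma w ** T u v z = sigma w ** T u v z ** u.
Proof.
move=> [T1 T2 T3]; have [[sinv _ sK] _ sM] := hsigma.
have b12 s : skew_biderivation (fun x y => T x y s) by split.
have Tuvu : T u v u = 0.
  have b13 : skew_biderivation (fun x s => T x v s) by split.
  by apply: (skew_biderivation_commuting0 b13); rewrite /rngcomm subrr.
apply/eqP; rewrite -subr_eq0; apply/eqP.
apply: comm_annihilator0 xy0 _ => // a b.
rewrite -[a]sK -[b]sK -rng_automorphism_comm.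
set x := sinv a; set y := sinv b; set c := sigma _.
(* With [z u] in the third slot, the terms containing [T u v u] vanish on both
   sides; [T x y z u w [u, v]] and [c sigma w T u v z u] are what remains. *)
have := skew_biderivation_comm x y u v w (b12 (z ** u)).
rewrite !(skew_derivationM z u (T3 _ _)) Tuvu rngmulr0 add0r !rngmulDl.
rewrite -[sigma z ** _ ** w ** _]rngmulA -[sigma z ** _ ** _]rngmulA.
rewrite [_ ** (w ** _)]rngmulA (skew_biderivation_comm _ _ _ _ _ (b12 u)) Tuvu.
rewrite !rngmulr0 add0r -[T x y z ** u ** w]rngmulA.
rewrite (skew_biderivation_comm _ _ _ _ _ (b12 z)) sM -/c => E.
by rewrite rngmulBr !rngmulA -[c ** sigma u ** _]rngmulA E !rngmulA subrr.
Qed.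

Lemma skew_triderivation0 T u v z : skew_triderivation T -> T u v z = 0.
Proof.
move=> tT; have [[sinv sinvK sK] _ sM] := hsigma.
have [uv | uv] := eqVneq (rngcomm (sigma u) (sigma v)) 0; last first.
  apply: prime_rng_eq0 uv => // r; rewrite -[r]sK; set w := sinv r.
  have := skew_triderivation_shift u v z (v ** w) tT.
  rewrite sM -[_ ** _ ** u]rngmulA -[_ ** _ ** (_ ** u)]rngmulA.
  rewrite [sigma w ** (_ ** u)]rngmulA -skew_triderivation_shift // => E.
  move: E; rewrite /rngcomm !rngmulBl -!rngmulA => ->.
  by rewrite subrr.
have {}uv : rngcomm u v = 0.
  by apply: (can_inj sinvK); rewrite rng_automorphism_comm uv rng_automorphism0.
case: tT => T1 T2 _.
have b12 : skew_biderivation (fun x y => T x y z) by split.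
exact: (skew_biderivation_commuting0 b12 uv).
Qed.

End SkewDerivations.

Section SetArg.
Variables (R : rngType) (n : nat).
Implicit Types (a : {ffun 'I_n -> R}) (i j : 'I_n).

Lemma set_arg_id a i : set_arg a i (a i) = a.
Proof. by apply/ffunP => k; rewrite ffunE; case: eqP => [->|]. Qed.

Lemma set_argC a i j x y : i != j ->
  set_arg (set_arg a i x) j y = set_arg (set_arg a j y) i x.
Proof.
move=> ij; apply/ffunP => k; rewrite !ffunE.
by have [->|//] := eqVneq k j; rewrite eq_sym (negbTE ij).
Qed.

Lemma skew_n_triderivation (sigma : R -> R) Delta a i j k :
  i != j -> i != k -> j != k -> skew_n_derivation sigma Delta ->
  skew_triderivation sigma
    (fun x y z => Delta (set_arg (set_arg (set_arg a i x) j y) k z)).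
Proof.
move=> ij ik jk sD; split=> [y z | x z | x y]; last exact: sD.
- have [DD DM] := sD i (set_arg (set_arg a j y) k z).
  have E x : set_arg (set_arg (set_arg a i x) j y) k z =
             set_arg (set_arg (set_arg a j y) k z) i x.
    by rewrite (set_argC _ _ _ ij) set_argC.
  by split=> x x'; rewrite !E.
- have [DD DM] := sD j (set_arg (set_arg a i x) k z).
  by split=> y y'; rewrite !(set_argC (set_arg a i x) _ _ jk).
Qed.

End SetArg.

Theorem theorem2p8 (R : rngType) (hR : prime_rng R)
    (sigma : R -> R) (hsigma : rng_automorphism sigma)
    (n : nat) (hn : (3 <= n)%N)
    (hDelta : exists Delta : {ffun 'I_n -> R} -> R,
        skew_n_derivation sigma Delta /\ (exists a, Delta a != 0)) :
  commutative_rng R.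
Proof.
have [Delta [sD [a Da]]] := hDelta => x y.
apply/eqP; rewrite -subr_eq0; apply: contraNT Da => xy.
pose i : 'I_n := Ordinal (ltn_trans (isT : 0 < 2)%N hn).
pose j : 'I_n := Ordinal (ltn_trans (isT : 1 < 2)%N hn).
pose k : 'I_n := Ordinal hn.
have tT := skew_n_triderivation a
  (isT : i != j) (isT : i != k) (isT : j != k) sD.
have := skew_triderivation0 hR hsigma xy (a i) (a j) (a k) tT.
by rewrite !set_arg_id => ->.
Qed.
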